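(* For any lacunary sequence $\theta=(k_r)$, one has $\Delta N^{0}_{\theta}\subset |\Delta\sigma^{0}_{1}|$ if and only if $\limsup_{r} q_r<\infty$.
   Context: All sequences are sequences of real numbers. A lacunary sequence is an increasing sequence of integers $\theta=(k_r)_{r\ge 0}$ with $k_0=0$ and $h_r:=k_r-k_{r-1}\to\infty$. Put $I_r=(k_{r-1},k_r]$ (integers in this interval) and $q_r=k_r/k_{r-1}$ (for $r\ge 2$). For a sequence $(\alpha_k)_{k\ge1}$, $\Delta\alpha_k=\alpha_{k+1}-\alpha_k$. $|\Delta\sigma_1^0|$ denotes the set of strongly Cesàro quasi-Cauchy sequences, i.e. those with $\lim_{n\to\infty}\frac1n\sum_{i=1}^n|\Delta\alpha_i|=0$. $\Delta N_\theta^0$ denotes the set of $N_\theta$-quasi-Cauchy sequences, i.e. those with $\lim_{r\to\infty}\frac1{h_r}\sum_{k\in I_r}|\Delta\alpha_k|=0$. *)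

(* Defs.v *)
From HB Require Import structures.
From mathcomp Require Import all_boot all_order all_algebra.
From mathcomp Require Import all_classical all_reals all_analysis.
Import Order.TTheory GRing.Theory Num.Theory.
Import numFieldNormedType.Exports.

Set Implicit Arguments.
Unset Strict Implicit.
Unset Printing Implicit Defensive.

Local Open Scope classical_set_scope.
Local Open Scope ring_scope.

(* A sequence (alpha_k)_(k >= 1) is encoded as a function on nat whose value at
   0 is never used.  Objects indexed by r >= 1 (or r >= 2) are likewise total
   functions of r; their finitely many extra values do not affect limits. *)

(* h_r = k_r - k_(r-1); for nondecreasing k the subtraction never truncates *)
Definition block_length (k : nat -> nat) (r : nat) : nat := (k r - k r.-1)%N.

(* The terms are natural numbers without loss of generality: an increasing
   integer sequence with k_0 = 0 is nonnegative. *)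
Definition lacunary (k : nat -> nat) : Prop :=
  [/\ k 0%N = 0%N, increasing_seq k & block_length k r @[r --> \oo] --> \oo].

(* q_r = k_r / k_(r-1) *)
Definition block_ratio (R : realType) (k : nat -> nat) (r : nat) : R :=
  (k r)%:R / (k r.-1)%:R.

(* [telescope alpha i] is alpha_(i+1) - alpha_i *)
Definition strongly_cesaro_quasi_cauchy (R : realType) : set (R ^nat) :=
  [set alpha : R ^nat |
    n%:R^-1 * (\sum_(1 <= i < n.+1) `|telescope alpha i|) @[n --> \oo] --> 0].

(* the summation range is k_(r-1) < i <= k_r *)
Definition lacunary_quasi_cauchy (R : realType) (k : nat -> nat) :
    set (R ^nat) :=
  [set alpha : R ^nat |
    (block_length k r)%:R^-1 *
      (\sum_((k r.-1).+1 <= i < (k r).+1) `|telescope alpha i|)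
    @[r --> \oo] --> 0].

(* Main.v *)
(** If [q_r <= M] eventually and every block average past [J] is at most [d],
    then [k_(r-1) < n <= k_r] gives
    [sum_(i <= n) |Delta alpha_i| <= C + d k_r <= C + d M n], where [C] is the
    sum up to [k_J].  If [q] is unbounded, let [Delta alpha] be the indicator
    of the intervals [(k_(r-1), 2 k_(r-1)]] over the indices [r] at which [q]
    reaches a record value: the corresponding block averages [1 / (q_r - 1)]
    vanish, while the Cesaro average at [2 k_(r-1)] is at least [1/2]. *)
Require Import Defs.
From mathcomp Require Import all_boot all_order all_algebra.
From mathcomp Require Import all_classical all_reals all_analysis.
From mathcomp Require Import zify lra.
Import Order.TTheory GRing.Theory Num.Theory.
Import numFieldNormedType.Exports.

Local Open Scope classical_set_scope.
Local Open Scope ring_scope.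

(** The limsup is an infimum of suprema over neighbourhoods of infinity, so it is below [+oo]
    exactly when one of these suprema is. *)
Lemma limn_esup_lty (R : realType) (u : R ^nat) :
  (limn_esup (fun r => (u r)%:E) < +oo)%E <->
  exists M N, forall r, (N <= r)%N -> u r <= M.
Proof.
rewrite /limn_esup limf_esupE; split.
  move=> /ereal_inf_lt[y [V [N _ NV] <-]] supy.
  exists (fine (ereal_sup ((fun r => (u r)%:E) @` V))), N => r Nr.
  have : ((u r)%:E <= ereal_sup ((fun r => (u r)%:E) @` V))%E.
    by apply: ereal_sup_ubound; exists r => //; exact: NV.
  by move: supy; case: ereal_sup.
move=> [M [N uM]]; apply: (@le_lt_trans _ _ M%:E); last exact: ltry.
apply: (@le_trans _ _ (ereal_sup ((fun r => (u r)%:E) @` [set r | N <= r]%N))).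
  by apply: ereal_inf_lbound; exists [set r | N <= r]%N => //; exists N.
by apply: ge_ereal_sup => _ [r /= Nr <-]; rewrite lee_fin uM.
Qed.

(** The first index at which [u] exceeds the sum [M] of the [|u s|], [s < N], is a record, and it is
    not below [N] because those values are at most [M]. *)
Lemma frequent_records (R : realType) (u : R ^nat) :
  (forall M N, exists2 r, (N <= r)%N & M < u r) ->
  forall N, exists2 r, (N <= r)%N & forall s, (s < r)%N -> u s < u r.
Proof.
move=> u_unbounded N; pose M := \sum_(s < N) `|u s|.
have [r0 _ Mr0] := u_unbounded M 0%N.
have [r Mr rmin] := ex_minnP (ex_intro (fun r => M < u r) r0 Mr0).
have belowM s : (s < r)%N -> u s <= M.
  by move=> sr; rewrite leNgt; apply/negP => /rmin; rewrite leqNgt sr.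
exists r => [|s /belowM/le_lt_trans]; last exact.
rewrite leqNgt; apply/negP => rN; move: Mr; rewrite ltNge => /negP; apply.
rewrite (le_trans (ler_norm _))// /M (bigD1 (Ordinal rN))//= lerDl.
exact: sumr_ge0.
Qed.

Section Blocks.
Variables (R : realType) (k : nat -> nat).
Hypothesis k_incr : increasing_seq k.
Implicit Types (x : R ^nat) (P : nat -> Prop).

Let sum_to x n : R := \sum_(1 <= i < n.+1) x i.
Let block_sum x r : R := \sum_((k r.-1).+1 <= i < (k r).+1) x i.

Lemma leq_increasing_seq n : (n <= k n)%N.
Proof.
elim: n => // n IH; apply: leq_ltn_trans IH _.
by have := k_incr n.+1 n; rewrite ltnn leEnat => /negbT; rewrite -ltnNge.
Qed.

Lemma sum_to_le x m n : (forall i, 0 <= x i) -> (m <= n)%N ->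
  sum_to x m <= sum_to x n.
Proof.
move=> x0 mn; rewrite /sum_to (@big_cat_nat _ _ _ m.+1 1 n.+1)//= lerDl.
by apply: sumr_ge0.
Qed.

Lemma sum_toS x r : sum_to x (k r.+1) = sum_to x (k r) + block_sum x r.+1.
Proof.
rewrite /sum_to /block_sum (@big_cat_nat _ _ _ (k r).+1)//=.
by rewrite ltnS -leEnat k_incr.
Qed.

(** Each block past [J] adds at most [d] times its length, and the lengths telescope. *)
Lemma sum_to_block_le x (d : R) J :
  (forall r, (J <= r)%N -> (block_length k r)%:R^-1 * block_sum x r <= d) ->
  forall r, (J <= r)%N ->
  sum_to x (k r) <= sum_to x (k J) + d * ((k r)%:R - (k J)%:R).
Proof.
move=> xd r; elim: r => [|r IH]; first by rewrite leqn0 => /eqP ->; lra.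
rewrite leq_eqVlt ltnS => /predU1P[<-|Jr]; first lra.
have kr : (k r < k r.+1)%N by rewrite ltnNge -leEnat k_incr ltnn.
have := xd r.+1 (leqW Jr).
rewrite /block_length /= ler_pdivrMl ?ltr0n ?subn_gt0//.
rewrite natrB ?(ltnW kr)// sum_toS; have := IH Jr; lra.
Qed.

Lemma cesaro_of_blocks x : (forall i, 0 <= x i) ->
  (exists M N, forall r, (N <= r)%N -> block_ratio R k r <= M) ->
  (block_length k r)%:R^-1 * block_sum x r @[r --> \oo] --> (0 : R) ->
  n%:R^-1 * sum_to x n @[n --> \oo] --> (0 : R).
Proof.
move=> x0 [M0 [N qM0]] /cvgr0_norm_le xblock.
pose M := Num.max M0 0; have M_ge0 : 0 <= M by rewrite le_max lexx orbT.
(* Once [n] is so large that the initial sum is at most [d n], the total is at most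
   [d n + d M n = e n]. *)
apply/cvgr0Pnorm_le => e e_gt0; pose d := e / (M + 1).
have d_gt0 : 0 < d by rewrite divr_gt0// ltr_wpDl.
have [J0 _ xJ0] := xblock d d_gt0.
(* The successor forces [r >= 2] for the block of [n] found below, so that [k r.-1] is a positive
   denominator. *)
pose J := (maxn J0 N).+1.
have xJ r : (J <= r)%N -> (block_length k r)%:R^-1 * block_sum x r <= d.
  move=> Jr; apply: le_trans (ler_norm _) _; apply: xJ0 => /=.
  by move: Jr; rewrite /J; lia.
near=> n.
have n_gt0 : (0 < n)%N by near: n; exact: nbhs_infty_gt.
have nJ : (k J < n)%N by near: n; exact: nbhs_infty_gt.
have Cn : sum_to x (k J) / d <= n%:R by near: n; exact: nbhs_infty_ger.
(* The least such [r] is the index of the block containing [n]. *)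
have [r nr rmin] :=
  ex_minnP (ex_intro (fun r => (n <= k r)%N) n (leq_increasing_seq n)).
have Jr : (J < r)%N.
  rewrite ltnNge; apply/negP; rewrite -k_incr leEnat => /(leq_trans nr).
  by rewrite leqNgt nJ.
have rn : (k r.-1 < n)%N.
  by rewrite ltnNge; apply/negP => /rmin; move: Jr; lia.
have kr_gt0 : (0 < k r.-1)%N.
  by apply: leq_trans (leq_increasing_seq _); move: Jr; rewrite /J; lia.
have krM : (k r)%:R <= M * n%:R.
  have : block_ratio R k r <= M.
    by rewrite le_max qM0// (leq_trans _ (ltnW Jr))// /J; lia.
  rewrite /block_ratio ler_pdivrMr ?ltr0n// => /le_trans; apply.
  by rewrite ler_wpM2l// ler_nat ltnW.
have S_ge0 : 0 <= sum_to x n by exact: sumr_ge0.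
rewrite ger0_norm; last by rewrite mulr_ge0// invr_ge0.
rewrite ler_pdivrMl ?ltr0n//.
have eE : e = d * (M + 1) by rewrite /d mulfVK// gt_eqF// ltr_wpDl.
have Sr := sum_to_block_le _ _ _ xJ _ (ltnW Jr).
have Sn := sum_to_le _ _ _ x0 nr.
have dk : d * (k r)%:R <= d * (M * n%:R) by rewrite ler_pM2l.
have dJ : 0 <= d * (k J)%:R by rewrite mulr_ge0// ltW.
move: Cn; rewrite ler_pdivrMr// => Cn.
rewrite eE; lra.
Unshelve. all: by end_near. Qed.

Definition initial_pieces P : R ^nat := fun i =>
  (`[< exists r, [/\ P r, (k r.-1 < i)%N & (i <= (k r.-1).*2)%N] >])%:R.

(** The hypothesis keeps each piece inside its own block; blocks being disjoint, no other piece
    reaches block [r]. *)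
Lemma initial_pieces_block P r i : (forall s, P s -> ((k s.-1).*2 <= k s)%N) ->
  (k r.-1 < i <= k r)%N ->
  initial_pieces P i = (`[< P r >] && (i <= (k r.-1).*2)%N)%:R.
Proof.
move=> Pk /andP[ri ir]; rewrite /initial_pieces; congr (nat_of_bool _)%:R.
apply/asboolP/andP => [[s [Ps si is2]]|[/asboolP Pr i2]]; last by exists r.
suff -> : r = s by split => //; apply/asboolP.
have ks := leq_trans is2 (Pk s Ps).
have : (k r.-1 < k s)%N := leq_trans ri ks.
have : (k s.-1 < k r)%N := leq_trans si ir.
rewrite !ltnNge -!leEnat !k_incr -!ltnNge => sr rs.
have r_gt0 : (0 < r)%N by case: (r) ri ir => //=; lia.
have s_gt0 : (0 < s)%N by case: (s) si ks => //=; lia.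
lia.
Qed.

Lemma initial_pieces_sum P r : (forall s, P s -> ((k s.-1).*2 <= k s)%N) ->
  P r ->
  \sum_((k r.-1).+1 <= i < (k r.-1).*2.+1) initial_pieces P i = (k r.-1)%:R.
Proof.
move=> Pk Pr; rewrite (eq_big_nat _ _ (F2 := fun=> 1)).
  by rewrite sumr_const_nat; congr (_ *+ _); lia.
move=> i /andP[ri i2]; rewrite (initial_pieces_block P r)//.
  by rewrite asboolT//= -ltnS i2.
by rewrite ri (leq_trans _ (Pk r Pr)).
Qed.

Lemma initial_pieces_block_sum P r :
  (forall s, P s -> ((k s.-1).*2 <= k s)%N) ->
  block_sum (initial_pieces P) r = `[< P r >]%:R * (k r.-1)%:R.
Proof.
move=> Pk; rewrite /block_sum; have [Pr|nPr] := asboolP (P r); last first.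
  rewrite mul0r big_nat big1// => i ri.
  by rewrite (initial_pieces_block P r)// asboolF.
have kr : (k r.-1 <= k r)%N by rewrite -leEnat k_incr leq_pred.
rewrite mul1r (@big_cat_nat _ _ _ (k r.-1).*2.+1)/=; last 2 first.
- by lia.
- by rewrite ltnS Pk.
rewrite initial_pieces_sum// [X in _ + X]big_nat big1 ?addr0// => i.
move=> /andP[i2 ir].
rewrite (initial_pieces_block P r)//; first by rewrite leqNgt i2 andbF.
by apply/andP; split=> //; lia.
Qed.

Lemma unbounded_ratio_counterexample :
  ~ (exists M N, forall r, (N <= r)%N -> block_ratio R k r <= M) ->
  exists x, [/\ forall i, 0 <= x i,
    (block_length k r)%:R^-1 * block_sum x r @[r --> \oo] --> (0 : R) &
    ~ (n%:R^-1 * sum_to x n @[n --> \oo] --> (0 : R))].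
Proof.
move=> unb; pose q := block_ratio R k.
have q_unb (M : R) (N : nat) : exists2 r, (N <= r)%N & M < q r.
  apply: contrapT => no; apply: unb; exists M, N => r Nr.
  by rewrite leNgt; apply/negP => Mr; apply: no; exists r.
(* [1 < r] makes [k r.-1] positive, [2 < q r] makes the piece fit in its block, and the record
   condition drives [q] to infinity along [P]. *)
pose P r := [/\ (1 < r)%N, 2 < q r & forall s, (s < r)%N -> q s < q r].
have P_gt0 r : (1 < r)%N -> (0 < k r.-1)%N.
  by move=> r1; apply: leq_trans (leq_increasing_seq _); lia.
have Pk r : P r -> ((k r.-1).*2 <= k r)%N.
  move=> [r1 + _]; rewrite /q /block_ratio ltr_pdivlMr ?ltr0n ?P_gt0//.
  by rewrite -natrM ltr_nat; lia.
have P_freq N : exists2 r, (N <= r)%N & P r.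
  have [r0 _ q0] := q_unb 2 0%N.
  have [r Nr rec] := frequent_records _ q q_unb (maxn N (maxn 2 r0.+1)).
  exists r; first by lia.
  split=> //; first by lia.
  by apply: lt_trans q0 (rec _ _); lia.
exists (initial_pieces P); split => [i||/cvgr0_norm_lt small].
- by rewrite ler0n.
(* Past [s], a block with [P r] has [q r > q s > 1 + 1/e], so its average [1 / (q r - 1)] is below
   [e]; all other blocks have sum 0. *)
- apply/cvgr0Pnorm_le => e e_gt0; have [s _ sq] := q_unb (1 + e^-1) 0%N.
  near=> r; have sr : (s < r)%N by near: r; exact: nbhs_infty_gt.
  rewrite initial_pieces_block_sum//; have [Pr|_] := asboolP (P r); last first.
    by rewrite mul0r mulr0 normr0 ltW.
  have [r1 _ rec] := Pr; have kr_gt0 := P_gt0 r r1.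
  have kr : (k r.-1 < k r)%N by have := Pk r Pr; lia.
  rewrite mul1r ger0_norm ?mulr_ge0 ?invr_ge0//.
  rewrite ler_pdivrMl ?ltr0n ?subn_gt0// natrB 1?ltnW//.
  have := lt_trans sq (rec s sr).
  rewrite /q /block_ratio ltr_pdivlMr ?ltr0n// => lekr.
  rewrite -ler_pdivrMr//; lra.
(* At [n = 2 k_(r-1)] the piece of block [r] alone contributes [n / 2], against a Cesaro average
   strictly below [1/2]. *)
- have [N _ smallN] := small 2^-1 ltac:(by rewrite invr_gt0).
  have [r Nr Pr] := P_freq N.+1.
  have r1 : (1 < r)%N by case: Pr.
  have kr_gt0 := P_gt0 r r1.
  have Nk : (N <= (k r.-1).*2)%N.
    by have := leq_increasing_seq r.-1; lia.
  have := smallN _ Nk; rewrite /= ltNge => /negP; apply.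
  rewrite ger0_norm; last first.
    by rewrite mulr_ge0 ?invr_ge0//; apply: sumr_ge0 => i _; rewrite ler0n.
  rewrite ler_pdivlMl ?ltr0n ?double_gt0// -muln2 natrM mulfK// muln2.
  rewrite /sum_to (@big_cat_nat _ _ _ (k r.-1).+1)//=; last by lia.
  rewrite initial_pieces_sum// lerDr.
  by apply: sumr_ge0 => i _; rewrite ler0n.
Unshelve. all: by end_near. Qed.

End Blocks.

Theorem theorem8 (R : realType) (k : nat -> nat) (hk : lacunary k) :
  @lacunary_quasi_cauchy R k `<=` @strongly_cesaro_quasi_cauchy R <->
  (limn_esup (fun r : nat => (block_ratio R k r)%:E) < +oo)%E.
Proof.
case: hk => _ k_incr _; rewrite limn_esup_lty; split => [sub|bnd alpha].
  apply: contrapT.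
  move=> /(unbounded_ratio_counterexample _ _ k_incr)[x [x0 xblock]].
  (* Partial sums of [x] give a sequence whose differences are [x], and the absolute values
     disappear since [x] is nonnegative. *)
  have xE m n : \sum_(m <= i < n) `|telescope (series x) i| =
                \sum_(m <= i < n) x i.
    by apply: eq_bigr => i _; rewrite seriesK ger0_norm.
  apply; have := sub (series x).
  rewrite /lacunary_quasi_cauchy /strongly_cesaro_quasi_cauchy /=.
  under eq_fun do rewrite xE.
  by move=> /(_ xblock); under eq_fun do rewrite xE.
exact: (cesaro_of_blocks _ _ k_incr (fun i => `|telescope alpha i|)).
Qed.
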